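(* There exist non $h$-expansive polynomial maps satisfying the following lower bound on the local entropy: that is, there exist $m\ge1$, a polynomial map $P:\mathbb{R}^m\to\mathbb{R}^m$, a compact set $K\subset\mathbb{R}^m$ with $P(K)\subset K$, and a constant $C>0$ such that $f=P|_K$ is not $h$-expansive and $$\limsup_{\varepsilon\to0}\,h_{\mathrm{loc}}(f,\varepsilon)\,|\log\varepsilon|>C.$$
   Context: Let $f:K\to K$ be continuous on a compact metric space with distance $d$ (here the Euclidean distance). $B_n(f,x,\varepsilon)=\{y: d(f^iy,f^ix)<\varepsilon,\ 0\le i\le n-1\}$. $r_n(f,\Lambda,\delta)$ is the smallest cardinality of a set $E\subset K$ such that for every $x\in\Lambda$ there is $y\in E$ with $d(f^ix,f^iy)<\delta$ for $0\le i\le n-1$. Put $h^*(f,\varepsilon)=\lim_{\delta\to0}\limsup_n\frac1n\log\sup_{x\in K}r_n(f,B_n(f,x,\varepsilon),\delta)$; $f$ is $h$-expansive if $h^*(f,\varepsilon)=0$ for some $\varepsilon>0$. For an $f$-invariant Borel probability measure $\mu$, $$h_{\mathrm{loc}}(\mu,\varepsilon)=\lim_{\sigma\to1,\ \sigma<1}\ \inf_{F:\ \mu(F)\ge\sigma}\ \lim_{\delta\to0}\limsup_{n\to\infty}\frac1n\log\sup_{x\in F}r_n(f,F\cap B_n(f,x,\varepsilon),\delta),$$ the infimum being over Borel sets $F$, and $h_{\mathrm{loc}}(f,\varepsilon)=\sup_\mu h_{\mathrm{loc}}(\mu,\varepsilon)$ over all $f$-invariant Borel probability measures. *)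

(* Defs.v *)
From HB Require Import structures.
From mathcomp Require Import all_boot all_order all_algebra finmap.
From mathcomp Require Import all_classical all_reals all_analysis.
From mathcomp Require mpoly.

Set Implicit Arguments.
Unset Strict Implicit.
Unset Printing Implicit Defensive.

Import Order.TTheory GRing.Theory Num.Theory.
Import numFieldTopology.Exports.

Local Open Scope classical_set_scope.
Local Open Scope ring_scope.
Local Open Scope ereal_scope.

(* The dynamical system is f : K -> K with the distance d. It is encoded by a
   set K of an ambient topological space T and by total functions
   f : T -> T and d : T -> T -> R; the definitions below only use the values
   of f and d on K when f maps K into itself. *)
Section local_entropy.
Context {R : realType} {T : ptopologicalType}.
Variables (d : T -> T -> R) (K : set T) (f : T -> T).

Definition bowen_ball (n : nat) (x : T) (e : R) : set T :=
  [set y | K y /\ forall i, (i < n)%N -> (d (iter i f y) (iter i f x) < e)%R].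

Definition spanning (n : nat) (L : set T) (delta : R) (E : {fset T}) : Prop :=
  [set` E] `<=` K /\
  forall x, L x -> exists2 y, y \in E &
    forall i, (i < n)%N -> (d (iter i f x) (iter i f y) < delta)%R.

(* The infimum is that of a set of natural numbers, hence it is attained as
   soon as a finite spanning set exists; it is +oo otherwise. *)
Definition span_card (n : nat) (L : set T) (delta : R) : \bar R :=
  ereal_inf [set (#|` E|%:R)%:E | E in spanning n L delta].

Definition tail_entropy (e : R) : \bar R :=
  lim (limn_esup (fun n => (n%:R^-1)%:E *
         lne (ereal_sup [set span_card n (bowen_ball n x e) delta | x in K]))
       @[delta --> (0 : R)^'+]).

Definition h_expansive : Prop := exists2 e : R, (0 < e)%R & tail_entropy e = 0.

Definition borel : Type := g_sigma_algebraType (@open T).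

(* A Borel probability measure on K is a Borel probability measure mu on T
   with mu K = 1 (K is closed in the intended use); the preimage of A under
   f : K -> K is K `&` f @^-1` A. *)
Definition invariant_measure (mu : probability borel R) : Prop :=
  mu K = 1 /\
  forall A : set borel, measurable A -> A `<=` K -> mu (K `&` f @^-1` A) = mu A.

Definition local_entropy_on (F : set T) (e : R) : \bar R :=
  lim (limn_esup (fun n => (n%:R^-1)%:E *
         lne (ereal_sup
           [set span_card n (F `&` bowen_ball n x e) delta | x in F]))
       @[delta --> (0 : R)^'+]).

Definition local_entropy_measure (mu : probability borel R) (e : R) : \bar R :=
  lim (ereal_inf [set local_entropy_on F e | F in
         [set F : set borel | [/\ measurable F, F `<=` K & sigma%:E <= mu F]]]
       @[sigma --> (1 : R)^'-]).

Definition local_entropy (e : R) : \bar R :=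
  ereal_sup [set local_entropy_measure mu e | mu in invariant_measure].

End local_entropy.

Definition euclidean_dist {R : realType} {m : nat} (x y : 'rV[R]_m) : R :=
  Num.sqrt (\sum_(i < m) (x ord0 i - y ord0 i) ^+ 2)%R.

Definition poly_map {R : realType} {m : nat} (P : 'I_m -> mpoly.mpoly m R)
    (x : 'rV[R]_m) : 'rV[R]_m :=
  (\row_(i < m) mpoly.meval (fun j => x ord0 j) (P i))%R.

(* Main.v *)
Require Import Defs.
From mathcomp Require Import all_boot all_order all_algebra.
From mathcomp Require Import finmap.
From mathcomp Require Import all_classical all_reals all_analysis.
From mathcomp Require Import measurable_realfun.
From mathcomp Require mpoly.
Import (canonicals) mpoly.
From mathcomp Require Import ring lra zify.

Set Implicit Arguments.
Unset Strict Implicit.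
Unset Printing Implicit Defensive.

Import Order.TTheory GRing.Theory Num.Theory.
Import numFieldTopology.Exports.

Local Open Scope classical_set_scope.
Local Open Scope ring_scope.

(** The map is the quadratic skew product
      f (x, y) = (2 x^2 - 1, 16 (1 + x) y - y^2)
    of the plane, over the angle doubling map written in the variable
    x = cos theta.  For every n the base has the periodic orbit
    x_i = cos (2^i a), a = 2 pi / (2^(n+1) + 1), of period n + 1: it starts
    close to the fixed point 1, the points x_0, ..., x_(n-1) are nonnegative,
    and x_n is exponentially close to -1.  Along x_0, ..., x_(n-1) the fiber map
    y |-> b y - y^2 has b >= 16, so it is almost linear and expands small y,
    whereas over x_n the coefficient eps = 16 (1 + x_n) lies between 4 / 4^n and
    16 / 2^n (width_bounds) and y |-> eps y - y^2 folds the interval [0, eps] in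
    two.  Folding sends [0, eps] to size eps^2, and the n expanding steps
    more than make up for the lost factor eps, so that the first return to the
    fiber over x_0 has two full branches: a horseshoe that never leaves heights
    in [0, eps].  It produces entropy log 2 in n + 1 steps inside a set whose
    diameter is at most eps at all times, while |log eps| is of order n; the
    product of the two stays bounded below.

    The horseshoe is coded by the doubling map u |-> 2 u mod 1 of [0, 1[:
    composing inverse branches along the binary digits of u gives a point
    code_pt u with f^(n+1) (code_pt u) = code_pt (2 u mod 1)
    (code_pt_semiconj). Averaging the images of Lebesgue measure along one
    period gives an invariant measure. If F has at least half of its mass, F
    contains a quarter of the codes over some fiber; all these points stay
    eps-close for ever, hence lie in one Bowen ball of radius 2 eps, and
    points traced by a common orbit for (n + 1) J steps have the same J first
    digits, hence have codes in an interval of length 2 / 2^J. So at least 2^J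
    / 8 orbits are needed (spanning_card_ge), which bounds the local entropy
    from below by log 2 / (2 (n + 1)) (coded_local_entropy_ge); the factor 2
    absorbs the constant 8. Taking for F the whole compact set shows that the
    tail entropy is positive at every scale. The compact set consists of all
    the points whose orbit stays in the square [-1, 1]^2. *)

(** * Lower bounds for limits superior and local entropies *)

Lemma le_lne {R : realType} (x y : \bar R) : (x <= y)%E -> (lne x <= lne y)%E.
Proof.
move=> xy; have [x0|x0] := leP x 0%E; first by rewrite le0_lneNy// leNye.
have y0 : (0 < y)%E := lt_le_trans x0 xy.
by rewrite lee_lne// in_itv/= leey ?ltW.
Qed.

Lemma le_limf_esup_term {R : realType} {T : choiceType} {X : filteredType T}
    (u : X -> \bar R) (F : set (set X)) (c : \bar R) :
  (forall V, F V -> exists2 x, V x & (c <= u x)%E) -> (c <= limf_esup u F)%E.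
Proof.
move=> h; apply: le_ereal_inf_tmp => _ [V FV <-].
have [x Vx cx] := h V FV; apply: le_trans cx _.
by apply: ereal_sup_ubound; exists x.
Qed.

Lemma le_limn_esup {R : realType} (u v : (\bar R)^nat) :
  (forall n, (u n <= v n)%E) -> (limn_esup u <= limn_esup v)%E.
Proof.
move=> uv; apply: le_ereal_inf_tmp => _ [V FV <-].
apply: (@le_trans _ _ (ereal_sup (u @` V))).
  by apply: ereal_inf_lbound; exists V.
apply: ge_ereal_sup => _ [n Vn <-]; apply: le_trans (uv n) _.
by apply: ereal_sup_ubound; exists n.
Qed.

Lemma limn_esup_ge_cofinal {R : realType} (u : (\bar R)^nat) (c : \bar R) :
  (forall m, exists2 n, (m <= n)%N & (c <= u n)%E) -> (c <= limn_esup u)%E.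
Proof.
move=> h; apply: le_limf_esup_term => V [m _ mV].
by have [n mn cn] := h m; exists n => //; apply: mV.
Qed.

Section entropy_bounds.
Context {R : realType} {T : ptopologicalType}.
Variables (d : T -> T -> R) (K : set T) (f : T -> T).
Local Open Scope ereal_scope.

Lemma span_card_anti n (L : set T) (a b : R) : (a <= b)%R ->
  span_card d K f n L b <= span_card d K f n L a.
Proof.
move=> ab; apply: ereal_inf_le_tmp => _ [E [EK Ecov] <-]; exists E => //.
split=> // x Lx; have [y yE xy] := Ecov x Lx; exists y => // i ni.
exact: lt_le_trans (xy i ni) ab.
Qed.

(** This monotonicity in delta is what makes the limits at 0 in the
    definitions of the entropies exist. *)
Lemma scaled_entropy_anti (S : nat -> T -> set T) (F : set T) (a b : R) :
  (a <= b)%R ->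
  limn_esup (fun n => (n%:R^-1)%:E *
    lne (ereal_sup [set span_card d K f n (S n x) b | x in F])) <=
  limn_esup (fun n => (n%:R^-1)%:E *
    lne (ereal_sup [set span_card d K f n (S n x) a | x in F])).
Proof.
move=> ab; apply: le_limn_esup => n; apply: lee_wpmul2l.
  by rewrite lee_fin invr_ge0.
apply: le_lne; apply: ge_ereal_sup => _ [x Fx <-].
apply: le_trans (span_card_anti _ _ ab) _.
by apply: ereal_sup_ubound; exists x.
Qed.

Lemma local_entropy_on_ge (F : set T) (e eta : R) (c : \bar R) : (0 < eta)%R ->
  (forall delta, (0 < delta <= eta)%R ->
     c <= limn_esup (fun n => (n%:R^-1)%:E *
       lne (ereal_sup [set span_card d K f n (F `&` bowen_ball d K f n x e) delta
                      | x in F]))) ->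
  c <= local_entropy_on d K f F e.
Proof.
move=> eta0 h; apply: lime_ge.
  apply: nonincreasing_at_right_is_cvge; near=> r => a b _ _ ab.
  exact: scaled_entropy_anti.
near=> delta; apply: h; apply/andP; split; first by near: delta; exact: nbhs_right_gt.
by near: delta; exact: nbhs_right_le.
Unshelve. all: by end_near. Qed.

(** Raising sigma leaves fewer sets F, so the infimum is nondecreasing in sigma
    and its limit at 1 exists; any threshold s < 1 then suffices for a lower
    bound. *)
Lemma local_entropy_measure_ge (mu : probability (@borel T) R) (e : R) (s : R)
    (c : \bar R) : (s < 1)%R ->
  (forall F : set (@borel T), measurable F -> F `<=` K -> s%:E <= mu F ->
     c <= local_entropy_on d K f F e) ->
  c <= local_entropy_measure d K f mu e.
Proof.
move=> s1 h; apply: lime_ge.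
  set g := (X in X @ _).
  have : cvg ((g \o -%R) x @[x --> (- 1)^'+]).
    apply: nonincreasing_at_right_is_cvge; near=> r => a b _ _ ab /=.
    apply: ereal_inf_le_tmp => _ [F [mF FK aF] <-]; exists F => //; split=> //.
    by apply: le_trans aF; rewrite lee_fin lerN2.
  by move=> /cvg_ex[/= l gl]; apply/cvg_ex; exists l; exact/cvg_at_leftNP.
apply: filterS (nbhs_left_ge s1) => t st.
apply: le_ereal_inf_tmp => _ [F [mF FK tF] <-].
by apply: h => //; apply: le_trans tF; rewrite lee_fin.
Unshelve. all: by end_near. Qed.

(** Bowen balls are subsets of K, so the two definitions agree for F = K. *)
Lemma tail_entropyE (e : R) : tail_entropy d K f e = local_entropy_on d K f K e.
Proof.
have KI n x : K `&` bowen_ball d K f n x e = bowen_ball d K f n x e.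
  by rewrite setIidr// => y [].
by rewrite /local_entropy_on; under [in RHS]eq_fun => delta do
  under eq_fun => n do under eq_imagel => x _ do rewrite KI.
Qed.

End entropy_bounds.

(** * Averages of image measures *)

Lemma pushforward_measure_exists d1 d2 (T1 : measurableType d1) (T2 : measurableType d2)
    (R : realFieldType) (m : {measure set T1 -> \bar R}) (h : T1 -> T2) :
  measurable_fun setT h ->
  exists nu : {measure set T2 -> \bar R}, forall A, nu A = m (h @^-1` A).
Proof.
by move=> mh; unshelve eexists (pushforward m h : {measure set T2 -> \bar R}).
Qed.

Lemma probability_of_mass1 d (T : measurableType d) (R : realType)
    (m : {measure set T -> \bar R}) : m setT = 1%E ->
  exists P : probability T R, forall A, P A = m A.
Proof.
move=> m1; exists (mnormalize m (dirac point)) => A /=.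
by rewrite /mnormalize m1 onee_eq0 /= invr1 mule1.
Qed.

(** Averaging images along one period turns invariance under a return map into
    invariance under the map itself. *)
Lemma average_pushforward d1 d2 (T1 : measurableType d1) (T2 : measurableType d2)
    (R : realType) (P : probability T1 R) (N : nat) (h : nat -> T1 -> T2) :
  (0 < N)%N -> (forall k, measurable_fun setT (h k)) ->
  exists mu : probability T2 R, forall A,
    mu A = ((N%:R^-1)%:E * \sum_(k < N) P (h k @^-1` A))%E.
Proof.
move=> N0 mh.
have [nu nuE] := choice (fun k => pushforward_measure_exists P (mh k)).
have NV0 : (0 : R) <= N%:R^-1 by rewrite invr_ge0.
pose m := mscale (NngNum NV0) (msum nu N).
have mE A : m A = ((N%:R^-1)%:E * \sum_(k < N) P (h k @^-1` A))%E.
  by rewrite /m /= /mscale /msum /=; congr (_ * _)%E; apply: eq_bigr => k _; rewrite nuE.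
have m1 : m setT = 1%E.
  rewrite mE (eq_bigr (fun=> 1%E)); last by move=> k _; rewrite preimage_setT probability_setT.
  by rewrite sumEFin -EFinM sumr_const card_ord mulVf// pnatr_eq0 -lt0n.
have [mu muE] := probability_of_mass1 m1.
by exists mu => A; rewrite muE -mE.
Qed.

(** * The doubling map and binary digits *)

Section doubling_map.
Context {R : realType}.
Local Notation leb := (@lebesgue_measure R).

Definition digit (u : R) : bool := 2^-1 <= u.
Definition doubling (u : R) : R := if digit u then 2 * u - 1 else 2 * u.

Lemma doubling_itv (u : R) : `[0, 1[%classic u -> `[0, 1[%classic (doubling u).
Proof.
rewrite /= !in_itv/= /doubling /digit => /andP[u0 u1].
by case: (lerP 2^-1 u) => h; apply/andP; split; lra.
Qed.

Lemma same_digits_close J (u v : R) : `[0, 1[%classic u -> `[0, 1[%classic v ->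
  (forall j, (j < J)%N -> digit (iter j doubling u) = digit (iter j doubling v)) ->
  `|u - v| <= 2^-1 ^+ J.
Proof.
elim: J u v => [|J IH] u v u01 v01 same.
  move: u01 v01; rewrite /= !in_itv/= expr0 ler_norml => /andP[? ?] /andP[? ?].
  by apply/andP; split; lra.
have := IH _ _ (doubling_itv u01) (doubling_itv v01).
have same' j : (j < J)%N ->
    digit (iter j doubling (doubling u)) = digit (iter j doubling (doubling v)).
  by rewrite -!iterSr => jJ; exact: same.
move=> /(_ same').
have -> : doubling u - doubling v = 2 * (u - v).
  by rewrite /doubling (same 0%N isT); case: ifP => _; ring.
rewrite normrM (@ger0_norm _ 2)// exprS => h.
by rewrite -ler_pdivrMl ?invr_gt0// invrK.
Qed.

Lemma measurable_digit : measurable_fun setT digit.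
Proof. by rewrite /digit; apply: measurable_fun_ler. Qed.

Lemma measurable_doubling : measurable_fun setT doubling.
Proof.
apply: measurable_fun_ifT; first exact: measurable_digit.
- apply: measurable_funB => //; exact: measurable_funM.
- exact: measurable_funM.
Qed.

(** Each branch halves lengths, so both sides agree on half-open intervals,
    and these determine a Borel measure. *)
Lemma lebesgue_two_branches (A : set R) : measurable A ->
  leb A = (leb [set u | A (2 * u)%R] + leb [set u | A (2 * u - 1)%R])%E.
Proof.
move=> mA.
have m0 : measurable_fun setT (fun u : measurableTypeR R => 2 * u : measurableTypeR R).
  exact: measurable_funM.
have m1 : measurable_fun setT (fun u : measurableTypeR R => 2 * u - 1: measurableTypeR R).
  by apply: measurable_funB => //; exact: measurable_funM.
have [nu0 nu0E] := pushforward_measure_exists leb m0.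
have [nu1 nu1E] := pushforward_measure_exists leb m1.
have := @lebesgue_measure_unique R (msum (fun n => if n is 0%N then nu0 else nu1) 2).
rewrite /= /msum.
move=> /(_ _ A) ->//; first by rewrite !big_ord_recl/= big_ord0 adde0 nu0E nu1E.
move=> X /ocitvP[->|[[a b]/= ab ->]].
  by rewrite measure0 !big_ord_recl big_ord0 /= !measure0 !adde0.
rewrite !big_ord_recl/= big_ord0 adde0 nu0E nu1E lebesgue_measure_itv/= lte_fin ab.
have -> : (fun u : R => 2 * u) @^-1` `]a, b] = `]a / 2, b / 2]%classic.
  by apply/seteqP; split=> x /=; rewrite !in_itv/= => /andP[? ?]; apply/andP; split; lra.
have -> : (fun u : R => 2 * u - 1) @^-1` `]a, b] = `](a + 1) / 2, (b + 1) / 2]%classic.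
  by apply/seteqP; split=> x /=; rewrite !in_itv/= => /andP[? ?]; apply/andP; split; lra.
rewrite !lebesgue_measure_itv/= !lte_fin !ltr_pM2r ?invr_gt0// ltrD2r ab.
by rewrite -!EFinD; congr EFin; lra.
Qed.

(** Apply lebesgue_two_branches to the part of A in the unit interval: its two
    preimages lie in [0, 1/2[ and [1/2, 1[, where doubling is the matching
    branch. *)
Lemma lebesgue_doubling (A : set R) : measurable A ->
  leb (doubling @^-1` A `&` `[0, 1[) = leb (A `&` `[0, 1[).
Proof.
move=> mA.
have mA' : measurable (A `&` `[0, 1[ : set R) by exact: measurableI.
have m0 : measurable_fun setT (fun u : measurableTypeR R => 2 * u : measurableTypeR R).
  exact: measurable_funM.
have m1 : measurable_fun setT (fun u : measurableTypeR R => 2 * u - 1: measurableTypeR R).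
  by apply: measurable_funB => //; exact: measurable_funM.
rewrite [RHS]lebesgue_two_branches// -measureU.
- congr leb; apply/seteqP; split=> u /=; rewrite !in_itv/= /doubling /digit.
    by case: (lerP 2^-1 u) => h [Au /andP[? ?]]; [right|left]; split => //; apply/andP; split; lra.
  by case=> -[Au /andP[? ?]]; case: (lerP 2^-1 u) => h;
    (split; [|apply/andP; split; lra]) => //; exfalso; lra.
- by rewrite -[X in measurable X]setTI; exact: m0.
- by rewrite -[X in measurable X]setTI; exact: m1.
- by apply/seteqP; split=> u //=; rewrite !in_itv/= => -[[_ /andP[? ?]] [_ /andP[? ?]]]; lra.
Qed.

End doubling_map.

(** * Entropy of systems coded by the doubling map *)

(** An orbit segment of length N of f realizes one step of the doubling map.
    The points of each slice f^k (h R) are at distance less than e, so the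
    entropy that they carry is invisible at scale e; the digit of the code is
    visible at scale eta at time N - 1 of each segment. *)
Section coded_system.
Context {R : realType} {T : ptopologicalType}.
Variables (d : T -> T -> R) (K : set T) (f : T -> T).
Variables (N : nat) (h : R -> T) (e eta : R).
Hypothesis N_gt0 : (0 < N)%N.
Hypothesis eta_gt0 : 0 < eta.
Hypothesis K_stable : forall x, K x -> K (f x).
Hypothesis h_in : forall u, K (h u).
Hypothesis h_semiconj : forall u, iter N f (h u) = h (doubling u).
Hypothesis h_close : forall u v k, (k < N)%N ->
  d (iter k f (h u)) (iter k f (h v)) < e.
Hypothesis h_separated : forall u v z, digit u != digit v ->
  d (iter N.-1 f (h u)) z < eta -> d (iter N.-1 f (h v)) z < eta -> False.
Hypothesis h_measurable : forall k,
  measurable_fun setT ((fun u => iter k f (h u)) : measurableTypeR R -> @borel T).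

Local Notation leb := (@lebesgue_measure R).
Local Notation I01 := (`[(0 : R), 1[%classic).
Local Notation orbit_at k := (fun u : R => iter k f (h u)).

Lemma iter_orbit q r u : iter (r + q * N) f (h u) = iter r f (h (iter q doubling u)).
Proof.
elim: q r u => [|q IH] r u; first by rewrite mul0n addn0.
by rewrite mulSn addnCA addnC iterD h_semiconj IH -iterSr.
Qed.

Lemma measurable_orbit_preimage k (A : set (@borel T)) : measurable A ->
  measurable ((orbit_at k) @^-1` A : set (measurableTypeR R)).
Proof. by move=> mA; have := h_measurable k measurableT mA; rewrite setTI. Qed.

Lemma orbit_in k u : K (iter k f (h u)).
Proof. by elim: k => [|k IH] /=; [exact: h_in|exact: K_stable]. Qed.

Lemma orbit_close u v k : d (iter k f (h u)) (iter k f (h v)) < e.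
Proof. by rewrite (divn_eq k N) addnC !iter_orbit h_close// ltn_mod. Qed.

Lemma traced_digits k J delta z u v : (k < N)%N -> delta <= eta ->
  (forall i, (i < N * J)%N -> d (iter i f (iter k f (h u))) (iter i f z) < delta) ->
  (forall i, (i < N * J)%N -> d (iter i f (iter k f (h v))) (iter i f z) < delta) ->
  forall j, (j < J)%N -> digit (iter j doubling u) = digit (iter j doubling v).
Proof.
move=> kN deta ud vd j jJ; apply/eqP; apply/negP => /negP dif.
(* the time at which the orbit issued from the k-th slice shows its j-th digit *)
pose i := (N.-1 - k + j * N)%N.
have iNJ : (i < N * J)%N.
  have : (j.+1 * N <= J * N)%N by rewrite leq_mul2r jJ orbT.
  by rewrite /i; nia.
have ik w : iter i f (iter k f (h w)) = iter N.-1 f (h (iter j doubling w)).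
  by rewrite -iterD -iter_orbit /i; congr iter; lia.
have := ud _ iNJ; have := vd _ iNJ; rewrite !ik => v1 u1.
by apply: (h_separated dif (z := iter i f z)); exact: lt_le_trans deta.
Qed.

(** The codes traced by one element of a spanning set share their first J digits,
    hence lie in an interval of length 2 / 2^J; since the codes of F fill measure
    at least 1/4, at least 2^J / 8 elements are needed. *)
Lemma spanning_card_ge (F : set T) k J delta (E : {fset T}) x :
  (k < N)%N -> delta <= eta ->
  measurable ((orbit_at k) @^-1` F `&` I01) ->
  (4^-1%:E <= leb ((orbit_at k) @^-1` F `&` I01))%E ->
  (exists2 u, F (iter k f (h u)) & x = iter k f (h u)) ->
  F `<=` K ->
  spanning d K f (N * J) (F `&` bowen_ball d K f (N * J) x e) delta E ->
  2 ^+ J / 8 <= (#|` E|%:R : R).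
Proof.
set A := _ `&` _ => kN deta mA A4 [u0 Fu0 ->] FK [_ Ecov].
pose traced z u := forall i, (i < N * J)%N ->
  d (iter i f (iter k f (h u))) (iter i f z) < delta.
have Atraced u : A u -> exists2 z, z \in E & traced z u.
  move=> [Fu _]; apply: Ecov; split => //; split; first exact: FK.
  by move=> i _; rewrite -!iterD orbit_close.
(* one code among those traced by z, when there is any *)
pose c z := get [set u | A u /\ traced z u].
pose B z : set R := `[c z - 2^-1 ^+ J, c z + 2^-1 ^+ J]%classic.
have AB : A `<=` \bigcup_(z in [set` E]) B z.
  move=> u Au; have [z zE uz] := Atraced u Au; exists z => //.
  have [Ac zc] : A (c z) /\ traced z (c z).
    by apply: (@getPex _ [set u | A u /\ traced z u]); exists u.
  have := same_digits_close Au.2 Ac.2 (traced_digits kN deta uz zc).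
  by rewrite ler_norml /B /= in_itv/= => /andP[? ?]; apply/andP; split; lra.
have p0 : 0 < 2^-1 ^+ J :> R by rewrite exprn_gt0// invr_gt0.
have BE z : leb (B z) = (2 * 2^-1 ^+ J)%:E.
  rewrite /B lebesgue_measure_itv/= lte_fin ifT; last by lra.
  by rewrite -EFinD; congr EFin; ring.
have := @content_sub_fsum _ _ _ leb _ [set` E] A B (finite_fset E).
move=> /(_ (fun z _ => measurable_itv _) mA AB).
rewrite (eq_fsbigr (fun=> (2 * 2^-1 ^+ J)%:E)); last by move=> z _; exact: BE.
rewrite fsbig_finite//= set_fsetK => h1.
have := le_trans A4 h1; rewrite sumEFin lee_fin big_const_seq count_predT iter_addr_0.
rewrite -[leRHS]mulr_natr => h2.
have -> : 2 ^+ J / 8 = 2 ^+ J / 2 * 4^-1 :> R by field.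
apply: (@le_trans _ _ (2 ^+ J / 2 * (2 * 2^-1 ^+ J * #|` E|%:R))).
  apply: ler_wpM2l; first by rewrite divr_ge0// exprn_ge0.
  exact: h2.
rewrite exprVn; have : 2 ^+ J != 0 :> R by rewrite expf_neq0.
by move: (2 ^+ J) => t t0; rewrite [leLHS](_ : _ = #|` E|%:R)//; field.
Qed.

(** Sampling at times N J gives growth rate (J - 3) log 2 / (N J), which is at
    least log 2 / (2 N) once J >= 6. *)
Lemma local_entropy_on_slice_ge (F : set T) k :
  (k < N)%N -> F `<=` K ->
  measurable ((orbit_at k) @^-1` F `&` I01) ->
  (4^-1%:E <= leb ((orbit_at k) @^-1` F `&` I01))%E ->
  ((ln 2 / (2 * N%:R))%:E <= local_entropy_on d K f F e)%E.
Proof.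
move=> kN FK mA A4; apply: (local_entropy_on_ge eta_gt0) => delta /andP[d0 deta].
apply: limn_esup_ge_cofinal => m; pose J := maxn m 6.
have J6 : (6 <= J)%N by rewrite leq_maxr.
exists (N * J)%N; first by rewrite (leq_trans (leq_maxl m 6))// leq_pmull.
have [u Fu] : exists u, F (iter k f (h u)).
  apply: contrapT => noF; move: A4; rewrite (_ : _ `&` _ = set0) ?measure0.
    by rewrite lee_fin leNgt invr_gt0 ltr0n.
  by rewrite -subset0 => u [Fu _]; apply: noF; exists u.
have span_ge : ((2 ^+ J / 8)%:E <= span_card d K f (N * J)
    (F `&` bowen_ball d K f (N * J) (iter k f (h u)) e) delta)%E.
  apply: le_ereal_inf_tmp => _ [E Espan <-]; rewrite lee_fin.
  by apply: (spanning_card_ge kN deta mA A4 _ FK Espan); exists u.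
have sup_ge : ((2 ^+ J / 8)%:E <= ereal_sup [set span_card d K f (N * J)
    (F `&` bowen_ball d K f (N * J) x e) delta | x in F])%E.
  by apply: le_trans span_ge _; apply: ereal_sup_ubound; exists (iter k f (h u)).
apply: le_trans (lee_wpmul2l _ (le_lne sup_ge)); last by rewrite lee_fin invr_ge0.
have p0 : 0 < 2 ^+ J / 8 :> R by rewrite divr_gt0// exprn_gt0.
rewrite lne_EFin// -EFinM lee_fin natrM.
have -> : 8 = 2 ^+ 3 :> R by ring.
rewrite ln_div ?posrE ?exprn_gt0// !lnXn// -(mulr_natr (ln 2) J) -(mulr_natr (ln 2) 3).
have N0 : 0 < N%:R :> R by rewrite ltr0n.
have J0 : 6 <= J%:R :> R by rewrite ler_nat.
have l2 : 0 < ln 2 :> R by rewrite ln_gt0// ltr1n.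
set l : R := ln 2 in l2 *; set n : R := N%:R in N0 *; set t : R := J%:R in J0 *.
have -> : (n * t)^-1 * (l * t - l * 3) = l / (2 * n) * (2 * (t - 3) / t).
  by field; apply/andP; split; rewrite gt_eqF//; lra.
apply: ler_peMr; first by rewrite divr_ge0 ?mulr_ge0 ?ltW.
by rewrite ler_pdivlMr; lra.
Qed.

Lemma coded_tail_entropy_gt0 : (0 < tail_entropy d K f e)%E.
Proof.
have A1 : (orbit_at 0%N) @^-1` K `&` I01 = I01.
  by rewrite setIidr// => u _; exact: h_in.
rewrite tail_entropyE; apply: lt_le_trans (@local_entropy_on_slice_ge K 0 _ _ _ _) => //.
- by rewrite lte_fin divr_gt0// ?ln_gt0 ?ltr1n// mulr_gt0// ltr0n.
- by rewrite A1.
- by rewrite A1 lebesgue_measure_itv/= lte_fin ltr01 -EFinD lee_fin; lra.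
Qed.

(** The average of the images of Lebesgue measure under f^k o h for k < N is
    invariant: f shifts the terms cyclically, the last one returning to the
    first by invariance under doubling. A set of mass 1/2 for the average has mass
    at least 1/4 for one of the terms. *)
Lemma coded_local_entropy_ge :
  ((ln 2 / (2 * N%:R))%:E <= local_entropy d K f e)%E.
Proof.
have m01 : measurable (I01 : set (measurableTypeR R)) by [].
have [P PE] : exists P : probability (measurableTypeR R) R,
    forall A, P A = leb (A `&` I01).
  apply: (@probability_of_mass1 _ _ _ (mrestr leb m01)).
  by rewrite /= /mrestr setTI lebesgue_measure_itv/= lte_fin ltr01 -EFinD subr0.
have [mu muE] := average_pushforward P N_gt0 h_measurable.
have N0 : 0 < N%:R :> R by rewrite ltr0n.
have mu_inv : invariant_measure K f mu.
  split.
    rewrite muE (eq_bigr (fun=> 1%E)).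
      by rewrite sumEFin -EFinM sumr_const card_ord mulVf// gt_eqF.
    move=> k _; rewrite (_ : _ @^-1` _ = setT) ?probability_setT//.
    by apply/seteqP; split=> // u _; exact: orbit_in.
  move=> A mA AK; rewrite !muE; congr (_ * _)%E.
  pose g k := P ((fun u => iter k f (h u)) @^-1` A).
  have gN : g N = g 0%N.
    rewrite /g !PE -[RHS]lebesgue_doubling; last exact: (measurable_orbit_preimage 0 mA).
    by congr (leb (_ `&` _)); apply/seteqP; split=> u /=; rewrite h_semiconj.
  rewrite (eq_bigr (fun k : 'I_N => g k.+1)); last first.
    move=> k _; rewrite /g; congr (P _); apply/seteqP; split=> u /=.
      by case.
    by split=> //; exact: orbit_in.
  rewrite -(prednK N_gt0) big_ord_recr [RHS]big_ord_recl /= (prednK N_gt0) gN addeC.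
  by congr (_ + _)%E.
apply: (@le_trans _ _ (local_entropy_measure d K f mu e)); last first.
  by apply: ereal_sup_ubound; exists mu.
apply: (@local_entropy_measure_ge _ _ _ _ _ _ _ 2^-1); first by lra.
move=> F mF FK F2.
have [k kF] : exists k : 'I_N, (4^-1%:E <= P ((fun u => iter k f (h u)) @^-1` F))%E.
  apply: contrapT => no; move: F2; rewrite muE; apply/negP; rewrite -ltNge.
  have le4 (k : 'I_N) : true -> (P ((fun u => iter k f (h u)) @^-1` F) <= 4^-1%:E)%E.
    by move=> _; apply/ltW; rewrite ltNge; apply/negP => h4; apply: no; exists k.
  apply: le_lt_trans (lee_wpmul2l _ (lee_sum _ le4)) _; first by rewrite lee_fin invr_ge0.
  rewrite sumEFin -EFinM lte_fin sumr_const card_ord -(mulr_natr 4^-1 N) mulrCA mulVf ?gt_eqF//.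
  lra.
apply: (@local_entropy_on_slice_ge F k) => //.
- by apply: measurableI => //; exact: measurable_orbit_preimage.
- by rewrite -PE.
Qed.

End coded_system.

(** * Periodic orbits of x |-> 2 x^2 - 1 passing close to -1 *)

Section base_orbit.
Context {R : realType}.
Variable n : nat.

(** Multiplying this angle by 2^(n+1) gives its opposite modulo 2 pi, which
    has the same cosine: this makes the orbit periodic of period n + 1. *)
Definition base_angle : R := pi *+ 2 / (2 ^+ n.+1 + 1).
Definition base (i : nat) : R := cos (base_angle * 2 ^+ i).
Definition rate (i : nat) : R := 16 * (1 + base i).

(** The coefficient over the last point of the period, where the fiber map
    folds: the horseshoe lives in heights [0, width]. *)
Definition width : R := rate n.

Lemma base_angleE : base_angle * 2 ^+ n.+1 = pi *+ 2 - base_angle.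
Proof.
rewrite /base_angle; have : 2 ^+ n.+1 + 1 != 0 :> R.
  by rewrite gt_eqF// ltr_pwDr// exprn_ge0.
by move: (2 ^+ n.+1) => t t1; field.
Qed.

Lemma baseS i : base i.+1 = 2 * base i ^+ 2 - 1.
Proof.
rewrite /base exprS (_ : _ * (2 * _) = (base_angle * 2 ^+ i) *+ 2); last by ring.
by rewrite cos_mulr2n -mulr_natl.
Qed.

Lemma base_period : base n.+1 = base 0.
Proof.
by rewrite /base base_angleE expr0 mulr1 addrC (periodicn (@cosD2pi R) 1) ?cosN.
Qed.

Lemma base_range i : -1 <= base i <= 1.
Proof. by rewrite cos_geN1 cos_le1. Qed.

Lemma base_ge0 i : (i < n)%N -> 0 <= base i.
Proof.
move=> i_n; apply: cos_ge0_pihalf.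
have pi0 : 0 < pi :> R by exact: pi_gt0.
have e0 : 0 < 2 ^+ n.+1 + 1 :> R by rewrite ltr_pwDr// exprn_ge0.
have h0 : 0 <= base_angle * 2 ^+ i.
  by rewrite mulr_ge0 ?exprn_ge0// divr_ge0// ?ltW// -(mulr_natr pi 2) mulr_gt0.
apply/andP; split; first by lra.
have : (2 ^+ i.+2 : R) <= 2 ^+ n.+1 by rewrite ler_eXn2l// ltr1n.
rewrite !(exprSr _ i.+1) !(exprSr _ i) => h.
rewrite /base_angle mulrAC ler_pdivrMr// -(mulr_natr pi 2).
have : 0 <= pi * (2 ^+ n.+1 + 1 - 2 ^+ i * 2 * 2) :> R by apply: mulr_ge0; lra.
lra.
Qed.

Lemma base_last_le0 : base n <= 0.
Proof.
have -> : base n = - cos (base_angle / 2).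
  rewrite -cosDpi /base -(cosN (base_angle * _)) -(periodicn (@cosD2pi R) 1).
  have := base_angleE; rewrite exprSr => h; congr cos.
  by rewrite mulr1n; lra.
rewrite oppr_le0; apply: cos_ge0_pihalf.
have pi0 : 0 < pi :> R by exact: pi_gt0.
have e0 : 0 < 2 ^+ n.+1 + 1 :> R by rewrite ltr_pwDr// exprn_ge0.
have h0 : 0 <= base_angle by rewrite divr_ge0// ?ltW// -(mulr_natr pi 2) mulr_gt0.
have e1 : 1 <= 2 ^+ n.+1 :> R by rewrite exprn_ege1// ler1n.
have : base_angle <= pi.
  rewrite /base_angle ler_pdivrMr// -(mulr_natr pi 2).
  have : 0 <= pi * (2 ^+ n.+1 + 1 - 2) :> R by apply: mulr_ge0; lra.
  lra.
by move=> h; apply/andP; split; lra.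
Qed.

Lemma rate_ge16 i : (i < n)%N -> 16 <= rate i.
Proof. by move=> /base_ge0 h; rewrite /rate; lra. Qed.

(** From 1 - base i.+1 = 2 (1 - base i) (1 + base i) with 0 <= base i <= 1: the
    distance to the fixed point 1 grows by a factor between 2 and 4. *)
Lemma gap_bounds i : (i <= n)%N ->
  2 ^+ i * (1 - base 0) <= 1 - base i <= 4 ^+ i * (1 - base 0).
Proof.
elim: i => [|i IH] i_n; first by rewrite !expr0 !mul1r lexx.
have /andP[lo hi] := IH (ltnW i_n).
have b0 := base_ge0 i_n; have /andP[_ b1] := base_range i.
rewrite !exprS -!mulrA baseS; apply/andP; split; nra.
Qed.

(** The distance 1 - base 0 controls width in two ways: by periodicity it
    equals 2 (1 - base n) (1 + base n), and by gap_bounds it reaches the size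
    1 - base n, which is between 1 and 2, after n steps. *)
Lemma width_bounds : 4 / 4 ^+ n <= width <= 16 / 2 ^+ n.
Proof.
have /andP[lo hi] := gap_bounds (leqnn n).
have /andP[bm _] := base_range n; have b0 := base_last_le0.
have gap0 : 1 - base 0 = 2 * (1 - base n) * (1 + base n).
  by rewrite -base_period baseS; ring.
have p2 : 0 < 2 ^+ n :> R by rewrite exprn_gt0.
have p4 : 0 < 4 ^+ n :> R by rewrite exprn_gt0.
rewrite /width /rate ler_pdivrMr// ler_pdivlMr//.
move: lo hi; rewrite gap0; move: (2 ^+ n) (4 ^+ n) p2 p4 => s t s0 t0 lo hi.
apply/andP; split; nra.
Qed.

End base_orbit.

(** * Inverse branches of y |-> b y - y^2 *)

Section inverse_branches.
Context {R : realType}.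

Definition branch (s : bool) (b v : R) : R :=
  (b + (if s then 1 else -1) * Num.sqrt (b ^+ 2 - 4 * v)) / 2.

Lemma branchK s (b v : R) : 4 * v <= b ^+ 2 ->
  b * branch s b v - branch s b v ^+ 2 = v.
Proof.
move=> vb; have : Num.sqrt (b ^+ 2 - 4 * v) ^+ 2 = b ^+ 2 - 4 * v.
  by rewrite sqr_sqrtr// subr_ge0.
by rewrite /branch; move: (Num.sqrt _) => r r2; case: s; lra.
Qed.

(** The value v = 3 b^2 / 16 is attained at b / 4 and 3 b / 4; below it the
    two preimages stay at distance at least b / 4 from the critical point b / 2, which
    separates the branches and bounds their derivatives. *)
Lemma sqrt_discriminant_bounds (b v : R) : 0 < b -> 0 <= v -> v <= 3 * b ^+ 2 / 16 ->
  b / 2 <= Num.sqrt (b ^+ 2 - 4 * v) <= b.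
Proof.
move=> b0 v0 vb; have b2 : 0 <= b ^+ 2 := sqr_ge0 b.
have bv : 0 <= b ^+ 2 - 4 * v by lra.
apply/andP; split.
  have bh : 0 <= b / 2 by lra.
  rewrite -[leLHS](ger0_norm bh) -sqrtr_sqr ler_sqrt//.
  by rewrite expr_div_n; lra.
by rewrite -[leRHS](ger0_norm (ltW b0)) -sqrtr_sqr ler_sqrt//; lra.
Qed.

Lemma branch_root (b v : R) s : 0 < b -> 0 <= v -> v <= 3 * b ^+ 2 / 16 ->
  b * branch s b v - branch s b v ^+ 2 = v.
Proof.
by move=> b0 v0 vb; apply: branchK; have b2 : 0 <= b ^+ 2 := sqr_ge0 b; lra.
Qed.

Lemma branch_range (b v : R) s : 0 < b -> 0 <= v -> v <= 3 * b ^+ 2 / 16 ->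
  0 <= branch s b v <= b.
Proof.
move=> b0 v0 vb; have := sqrt_discriminant_bounds b0 v0 vb; rewrite /branch.
by move: (Num.sqrt _) => r /andP[? ?]; case: s; apply/andP; split; lra.
Qed.

Lemma branch_low (b v : R) : 0 < b -> 0 <= v -> v <= 3 * b ^+ 2 / 16 ->
  branch false b v <= b / 4.
Proof.
move=> b0 v0 vb; have := sqrt_discriminant_bounds b0 v0 vb; rewrite /branch.
by move: (Num.sqrt _) => r /andP[? ?]; lra.
Qed.

Lemma branch_high (b v : R) : 0 < b -> 0 <= v -> v <= 3 * b ^+ 2 / 16 ->
  3 * b / 4 <= branch true b v.
Proof.
move=> b0 v0 vb; have := sqrt_discriminant_bounds b0 v0 vb; rewrite /branch.
by move: (Num.sqrt _) => r /andP[? ?]; lra.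
Qed.

Lemma branch_low_small (b v : R) : 0 < b -> 0 <= v -> v <= 3 * b ^+ 2 / 16 ->
  branch false b v <= 2 * v / b.
Proof.
move=> b0 v0 vb; have := branch_low b0 v0 vb.
have := branch_root false b0 v0 vb; have := branch_range false b0 v0 vb.
move: (branch _ _ _) => y /andP[? ?] ? ?.
by rewrite ler_pdivlMr//; nra.
Qed.

(** For two points y, z of one branch, the values differ by
    (b - y - z) (y - z), with |b - y - z| >= b / 2. *)
Lemma branch_lip s (b v w : R) : 0 < b ->
  0 <= v <= 3 * b ^+ 2 / 16 -> 0 <= w <= 3 * b ^+ 2 / 16 ->
  `|branch s b v - branch s b w| <= 2 / b * `|v - w|.
Proof.
move=> b0 /andP[v0 vb] /andP[w0 wb].
rewrite -{2}(branch_root s b0 v0 vb) -{2}(branch_root s b0 w0 wb).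
set y := branch s b v; set z := branch s b w.
have -> : b * y - y ^+ 2 - (b * z - z ^+ 2) = (b - y - z) * (y - z) by ring.
rewrite normrM mulrA -{1}(mul1r `|y - z|); apply: ler_wpM2r => //.
rewrite mulrAC ler_pdivlMr// mul1r.
rewrite -ler_pdivrMl// mulrC ler_normr; rewrite /y /z; case: (s).
  have := branch_high b0 v0 vb; have := branch_high b0 w0 wb => ? ?.
  by apply/orP; right; lra.
have := branch_low b0 v0 vb; have := branch_low b0 w0 wb => ? ?.
by apply/orP; left; lra.
Qed.

Lemma branch_continuous s (b : R) : continuous (branch s b).
Proof.
move=> v.
have disc : {for v, continuous (fun x : R => b ^+ 2 - 4 * x)}.
  by apply: cvgB; [exact: cvg_cst|apply: cvgMr; exact: cvg_id].
have root := continuous_comp disc (@sqrt_continuous R (b ^+ 2 - 4 * v)).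
by apply: cvgMl; apply: cvgD; [exact: cvg_cst|apply: cvgMr; exact: root].
Qed.

End inverse_branches.

(** * The polynomial map and its compact invariant set *)

Section polynomial_map.
Context {R : realType}.

Definition plane_pt (x y : R) : 'rV[R]_2 := \row_i (if i == ord0 then x else y).

Lemma plane_pt0 (x y : R) : plane_pt x y ord0 ord0 = x.
Proof. by rewrite mxE. Qed.

Lemma plane_pt1 (x y : R) : plane_pt x y ord0 ord_max = y.
Proof. by rewrite mxE. Qed.

Definition fold_poly (i : 'I_2) : mpoly.mpoly 2 R :=
  let X := mpoly.mpolyX R (mpoly.mnm1 (ord0 : 'I_2)) in
  let Y := mpoly.mpolyX R (mpoly.mnm1 (ord_max : 'I_2)) in
  if i == ord0 then X * X + X * X - 1 else mpoly.mpolyC 2 16 * ((1 + X) * Y) - Y * Y.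

Definition fold_map : 'rV[R]_2 -> 'rV[R]_2 := poly_map fold_poly.

Lemma fold_mapE p : fold_map p = plane_pt (2 * p ord0 ord0 ^+ 2 - 1)
  (16 * (1 + p ord0 ord0) * p ord0 ord_max - p ord0 ord_max ^+ 2).
Proof.
apply/rowP => i; rewrite !mxE /fold_poly; case: ifP => _.
  rewrite mpoly.mevalB mpoly.mevalD !mpoly.mevalM !mpoly.mevalXU mpoly.meval1.
  by ring.
rewrite mpoly.mevalB !mpoly.mevalM mpoly.mevalD mpoly.meval1 mpoly.mevalC !mpoly.mevalXU.
by ring.
Qed.

Lemma euclidean_dist_coord m (x y : 'rV[R]_m) i :
  `|x ord0 i - y ord0 i| <= euclidean_dist x y.
Proof.
rewrite -sqrtr_sqr ler_sqrt ?sumr_ge0// => [|j _]; last exact: sqr_ge0.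
by rewrite (bigD1 i)//= lerDl sumr_ge0// => j _; exact: sqr_ge0.
Qed.

Lemma euclidean_dist_fiber (x y z : R) :
  euclidean_dist (plane_pt x y) (plane_pt x z) = `|y - z|.
Proof.
by rewrite /euclidean_dist big_ord_recl big_ord1 !mxE/= subrr expr0n add0r sqrtr_sqr.
Qed.

Lemma row_continuous m (X : topologicalType) (g : X -> 'rV[R]_m) :
  (forall j, continuous (fun x => g x ord0 j)) -> continuous g.
Proof.
move=> cg x A [P gP PA].
have : \forall y \near x, forall j, P ord0 j (g y ord0 j).
  by apply: filter_forall => j; apply: cg; exact: gP.
by apply: filterS => y Py; apply: PA => i j; rewrite ord1.
Qed.

Lemma plane_pt_continuous (X : topologicalType) (a b : X -> R) :
  continuous a -> continuous b -> continuous (fun x => plane_pt (a x) (b x)).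
Proof.
move=> ca cb; apply: row_continuous => j.
have -> : (fun x => plane_pt (a x) (b x) ord0 j) = if j == ord0 then a else b.
  by apply/funext => x; rewrite mxE; case: ifP.
by case: ifP.
Qed.

Lemma fold_map_continuous : continuous fold_map.
Proof.
rewrite (_ : fold_map = fun p => plane_pt (2 * p ord0 ord0 ^+ 2 - 1)
  (16 * (1 + p ord0 ord0) * p ord0 ord_max - p ord0 ord_max ^+ 2)); last first.
  by apply/funext => p; rewrite fold_mapE.
have c0 := @coord_continuous R 1 2 ord0 ord0.
have c1 := @coord_continuous R 1 2 ord0 ord_max.
have cc (c : R) (p : 'rV[R]_2) : {for p, continuous (fun=> c)} by exact: cst_continuous.
apply: plane_pt_continuous => p.
  exact: (continuousB (continuousM (cc 2 p) (continuousM (c0 p) (c0 p))) (cc 1 p)).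
apply: (continuousB _ (continuousM (c1 p) (c1 p))).
exact: (continuousM (continuousM (cc 16 p) (continuousD (cc 1 p) (c0 p))) (c1 p)).
Qed.

Lemma iter_fold_map_continuous k : continuous (fun p => iter k fold_map p).
Proof.
elim: k => [|k IH] p /=; first exact: cvg_id.
by apply: continuous_comp; [exact: IH|exact: fold_map_continuous].
Qed.

Definition box : set 'rV[R]_2 := [set p | forall i, `[(-1 : R), 1]%classic (p ord0 i)].
(** The largest forward invariant subset of the square, an intersection of
    preimages of the square and hence closed. *)
Definition trapped : set 'rV[R]_2 := [set p | forall k, box (iter k fold_map p)].

Lemma trapped_compact : compact trapped.
Proof.
apply: (@subclosed_compact _ _ box).
- have -> : trapped = \bigcap_k ((fun p => iter k fold_map p) @^-1` box).
    by apply/seteqP; split=> p bp k; [move=> _|]; exact: bp.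
  apply: closed_bigI => k _.
  apply: closed_comp => [p _|]; first exact: iter_fold_map_continuous.
  have -> : box = \bigcap_i ((fun p : 'rV[R]_2 => p ord0 i) @^-1` `[(-1 : R), 1]%classic).
    by apply/seteqP; split=> p bp i; [move=> _|]; exact: bp.
  apply: closed_bigI => i _; apply: closed_comp => [p _|]; first exact: coord_continuous.
  exact: interval_closed.
- by apply: (@rV_compact _ _ (fun=> `[(-1 : R), 1]%classic)) => i; apply: segment_compact.
- by move=> p /(_ 0%N).
Qed.

Lemma trapped_stable p : trapped p -> trapped (fold_map p).
Proof. by move=> Kp k; rewrite -iterSr; exact: Kp. Qed.

End polynomial_map.

(** * Heights coded by binary digits *)

Section coding.
Context {R : realType}.
Variable n : nat.
Hypothesis n_ge10 : (10 <= n)%N.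

Local Notation eps := (@width R n).
Local Notation base := (@base R n).
Local Notation rate := (@rate R n).

(** Bound for the heights over base 0: the values that both branches of the
    fold over base n reach with some room. *)
Definition entry_height : R := 3 * eps ^+ 2 / 16.

Lemma width_gt0 : 0 < eps.
Proof.
have /andP[h _] := @width_bounds R n; apply: lt_le_trans h.
by rewrite divr_gt0// exprn_gt0.
Qed.

Lemma width_le1 : eps <= 1.
Proof.
have /andP[_ h] := @width_bounds R n; apply: le_trans h _.
rewrite ler_pdivrMr ?exprn_gt0// mul1r (_ : 16 = 2 ^+ 4); last by ring.
by rewrite ler_eXn2l ?ltr1n//; lia.
Qed.

Lemma entry_height_ge0 : 0 <= entry_height.
Proof. by rewrite /entry_height; have := sqr_ge0 eps; lra. Qed.

Lemma entry_height_le1 : entry_height <= 1.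
Proof. by rewrite /entry_height; have := width_gt0; have := width_le1; nra. Qed.

(** The height over base 0 from which the orbit climbs to height v over
    base k, following the small inverse branches. *)
Fixpoint pull_back (k : nat) (v : R) : R :=
  if k is k'.+1 then pull_back k' (branch false (rate k') v) else v.

Lemma branch_contract k v : (k < n)%N -> 0 <= v <= 1 ->
  0 <= branch false (rate k) v <= v / 8.
Proof.
move=> kn /andP[v0 v1]; have r16 := @rate_ge16 R n k kn.
have r0 : 0 < rate k by lra.
have vr : v <= 3 * rate k ^+ 2 / 16 by nra.
have /andP[-> _] := branch_range false r0 v0 vr; apply: le_trans (branch_low_small r0 v0 vr) _.
by rewrite ler_pdivrMr//; nra.
Qed.

Lemma pull_back_range k v : (k <= n)%N -> 0 <= v <= 1 ->
  0 <= pull_back k v <= v / 8 ^+ k.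
Proof.
elim: k v => [|k IH] v kn /andP[v0 v1] /=; first by rewrite expr0 divr1 v0 lexx.
have v01 : 0 <= v <= 1 by rewrite v0.
have /andP[w0 wv] := branch_contract kn v01.
have /andP[h1 h2] : 0 <= pull_back k (branch false (rate k) v) <=
    branch false (rate k) v / 8 ^+ k.
  by apply: IH (ltnW kn) _; apply/andP; split=> //; lra.
by rewrite h1 (le_trans h2)// exprS invfM mulrA ler_wpM2r.
Qed.

Lemma pull_back_lip k v w : (k <= n)%N -> 0 <= v <= 1 -> 0 <= w <= 1 ->
  `|pull_back k v - pull_back k w| <= `|v - w| / 8 ^+ k.
Proof.
elim: k v w => [|k IH] v w kn v01 w01 /=; first by rewrite expr0 divr1.
have /andP[v0 v1] := v01; have /andP[w0 w1] := w01.
have /andP[v0' vv] := branch_contract kn v01.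
have /andP[w0' ww] := branch_contract kn w01.
apply: (le_trans (IH _ _ (ltnW kn) _ _)); try by apply/andP; split=> //; lra.
rewrite exprS invfM mulrA ler_wpM2r// ?invr_ge0 ?exprn_ge0//.
have r16 := @rate_ge16 R n k kn.
have r0 : 0 < rate k by lra.
have vr : 0 <= v <= 3 * rate k ^+ 2 / 16 by apply/andP; split=> //; nra.
have wr : 0 <= w <= 3 * rate k ^+ 2 / 16 by apply/andP; split=> //; nra.
apply: le_trans (branch_lip false r0 vr wr) _.
rewrite mulrC; apply: ler_wpM2l => //.
by rewrite ler_pdivrMr//; lra.
Qed.

Lemma iter_pull_back k (v : R) : (k <= n)%N -> 0 <= v <= 1 ->
  iter k fold_map (plane_pt (base 0) (pull_back k v)) = plane_pt (base k) v.
Proof.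
elim: k v => [//|k IH] v kn v01.
have /andP[w0 wv] := branch_contract kn v01; have /andP[v0 v1] := v01.
rewrite iterS /= IH ?(ltnW kn)//; last by apply/andP; split=> //; lra.
rewrite fold_mapE plane_pt0 plane_pt1 -baseS; congr plane_pt.
have r16 := @rate_ge16 R n k kn.
have r0 : 0 < rate k by lra.
by rewrite (branch_root false r0 v0)//; nra.
Qed.

Lemma iter_pull_back_height i k (v : R) : (i <= k)%N -> (k <= n)%N -> 0 <= v <= 1 ->
  exists2 z, iter i fold_map (plane_pt (base 0) (pull_back k v)) = plane_pt (base i) z
    & 0 <= z <= v.
Proof.
elim: k v => [|k IH] v ik kn v01.
  move: ik; rewrite leqn0 => /eqP ->; exists v => //.
  by have /andP[-> _] := v01; rewrite lexx.
have /andP[v0 v1] := v01.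
move: ik; rewrite leq_eqVlt => /predU1P[->|ik].
  by exists v; [exact: iter_pull_back|rewrite v0 lexx].
have /andP[w0 wv] := branch_contract kn v01.
have [|z zE /andP[z0 zw]] := IH (branch false (rate k) v) ik (ltnW kn).
  by apply/andP; split=> //; lra.
by exists z => //; apply/andP; split=> //; lra.
Qed.

(** The two inverse branches of the first return to the fiber over base 0. *)
Definition return_branch (s : bool) (v : R) : R := pull_back n (branch s eps v).

Lemma fold_range s v : 0 <= v <= entry_height -> 0 <= branch s eps v <= eps.
Proof.
by move=> /andP[v0 vt]; exact: (branch_range s width_gt0 v0 vt).
Qed.

Lemma fold_range1 s v : 0 <= v <= entry_height -> 0 <= branch s eps v <= 1.
Proof.
move=> /(fold_range s)/andP[h0 h1]; rewrite h0; exact: le_trans h1 width_le1.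
Qed.

(** The expansion over the first n points, at least 8^n, beats the loss of a
    factor width in the fold because width is at least 4 / 4^n. *)
Lemma shrink_le : (8 ^+ n)^-1 <= 3 * eps / 16.
Proof.
have /andP[h _] := @width_bounds R n.
apply: (@le_trans _ _ (3 * (4 / 4 ^+ n) / 16)); last by lra.
rewrite (_ : 8 = 4 * 2); last by ring.
have p4 : 0 < 4 ^+ n :> R by rewrite exprn_gt0.
have p2 : 2 <= 2 ^+ n :> R by rewrite -{1}(expr1 2) ler_eXn2l ?ltr1n//; lia.
rewrite exprMn invfM [leRHS](_ : _ = (4 ^+ n)^-1 * (3 / 4)); last by field; lra.
apply: ler_wpM2l; first by rewrite invr_ge0 ltW.
have p0 : 0 < 2 ^+ n :> R by lra.
by rewrite -[leLHS]mul1r ler_pdivrMr//; lra.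
Qed.

Lemma return_branch_range s v : 0 <= v <= entry_height ->
  0 <= return_branch s v <= entry_height.
Proof.
move=> vt; have /andP[h0 h1] := pull_back_range (leqnn n) (fold_range1 s vt).
rewrite /return_branch h0; apply: le_trans h1 _.
have /andP[w0 w1] := fold_range s vt; have s0 := shrink_le.
have e0 := width_gt0; rewrite /entry_height.
have i0 : 0 <= (8 ^+ n)^-1 :> R by rewrite invr_ge0 exprn_ge0.
by nra.
Qed.

(** The fold branch expands by at most 2 / width, which shrink_le compensates. *)
Lemma return_branch_lip s v w : 0 <= v <= entry_height -> 0 <= w <= entry_height ->
  `|return_branch s v - return_branch s w| <= 2^-1 * `|v - w|.
Proof.
move=> vt wt.
have := pull_back_lip (leqnn n) (fold_range1 s vt) (fold_range1 s wt).
move=> /le_trans; apply.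
have e0 := width_gt0; have := branch_lip s e0 vt wt; have := shrink_le.
set x := `|v - w|; set y := (8 ^+ n)^-1; set z := `|branch s _ v - _| => ye zx.
have x0 : 0 <= x by exact: normr_ge0.
have z0 : 0 <= z by exact: normr_ge0.
have zx' : z * eps <= 2 * x by rewrite -ler_pdivlMr// mulrAC.
apply: le_trans (ler_wpM2l z0 ye) _; lra.
Qed.

Lemma return_branch_continuous s : continuous (return_branch s).
Proof.
have pull_back_continuous k : continuous (pull_back k).
  elim: k => [|k IH] v /=; first exact: cvg_id.
  by apply: continuous_comp; [exact: branch_continuous|exact: IH].
move=> v; apply: continuous_comp; first exact: branch_continuous.
exact: pull_back_continuous.
Qed.

Fixpoint approx_height (k : nat) (u : R) : R :=
  if k is k'.+1 then return_branch (digit u) (approx_height k' (doubling u)) else 0.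

Lemma approx_height_range k u : 0 <= approx_height k u <= entry_height.
Proof.
elim: k u => [|k IH] u /=; first by rewrite lexx entry_height_ge0.
exact: return_branch_range.
Qed.

Lemma approx_height_cauchy k u :
  `|approx_height k.+1 u - approx_height k u| <= 2^-1 ^+ k.
Proof.
elim: k u => [|k IH] u.
  have /andP[h0 h1] := approx_height_range 1 u; have := entry_height_le1.
  by rewrite expr0 [approx_height 0 u]/= subr0 ger0_norm//; lra.
rewrite [approx_height k.+2 u]/= [approx_height k.+1 u in X in _ - X]/=.
apply: le_trans (return_branch_lip _ (approx_height_range k.+1 _) (approx_height_range k _)) _.
by rewrite exprS ler_wpM2l ?invr_ge0.
Qed.

Lemma approx_height_measurable k : measurable_fun setT (approx_height k).
Proof.
elim: k => [|k IH] /=; first exact: measurable_cst.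
rewrite (_ : (fun u => _) = (fun u => if digit u
    then return_branch true (approx_height k (doubling u))
    else return_branch false (approx_height k (doubling u)))); last first.
  by apply/funext => u; case: (digit u).
have mD := measurableT_comp IH measurable_doubling.
apply: measurable_fun_ifT; first exact: measurable_digit.
  exact: (measurableT_comp (continuous_measurable_fun (@return_branch_continuous true)) mD).
exact: (measurableT_comp (continuous_measurable_fun (@return_branch_continuous false)) mD).
Qed.

Lemma approx_height_is_cvg u : cvgn (approx_height ^~ u).
Proof.
have -> : (approx_height ^~ u) = series (telescope (approx_height ^~ u)).
  by rewrite telescopeK; apply/funext => k /=; rewrite subr0.
apply: normed_cvg; apply: (series_le_cvg (v_ := geometric 1 2^-1)) => //.
- by move=> k; exact: normr_ge0.
- by move=> k; rewrite [leRHS]mul1r; apply: exprn_ge0; lra.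
- by move=> k; rewrite [leRHS]mul1r; exact: approx_height_cauchy.
- by apply: is_cvg_geometric_series; rewrite ger0_norm//; lra.
Qed.

(** The height over base 0 whose itinerary through the horseshoe is the
    sequence of binary digits of u. *)
Definition height (u : R) : R := limn (approx_height ^~ u).

Lemma height_range u : 0 <= height u <= entry_height.
Proof.
have cu : cvgn (approx_height ^~ u) by exact: approx_height_is_cvg.
apply/andP; split.
  by apply: limr_ge => //; near=> k; have /andP[] := approx_height_range k u.
by apply: limr_le => //; near=> k; have /andP[] := approx_height_range k u.
Unshelve. all: by end_near. Qed.

Lemma heightE u : height u = return_branch (digit u) (height (doubling u)).
Proof.
apply: cvg_lim => //.
have cD : approx_height k (doubling u) @[k --> \oo] --> height (doubling u).
  exact: approx_height_is_cvg.
have step := cvg_comp (fun k => approx_height k (doubling u)) (return_branch (digit u))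
  cD (@return_branch_continuous (digit u) (height (doubling u))).
by rewrite -(cvg_shiftS (approx_height ^~ u)); exact: step.
Qed.

Lemma height_measurable : measurable_fun setT height.
Proof.
apply: (measurable_fun_cvg (h := approx_height)) => [k|u _].
  exact: approx_height_measurable.
exact: approx_height_is_cvg.
Qed.

End coding.

(** * The coded horseshoe at scale width *)

Section coded_plane_system.
Context {R : realType}.
Variable n : nat.
Hypothesis n_ge10 : (10 <= n)%N.

Local Notation eps := (@width R n).

Definition code_pt (u : R) : 'rV[R]_2 := plane_pt (base n 0) (height n u).

(* the height over base n of the orbit coded by u *)
Let w u := branch (digit u) eps (height n (doubling u)).

Lemma code_pt_last u : iter n fold_map (code_pt u) = plane_pt (base n n) (w u).
Proof.
rewrite /code_pt (heightE n_ge10); apply: iter_pull_back => //.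
exact: (fold_range1 n_ge10 _ (height_range n_ge10 _)).
Qed.

Lemma code_pt_height k u : (k <= n)%N ->
  exists2 z, iter k fold_map (code_pt u) = plane_pt (base n k) z & 0 <= z <= eps.
Proof.
move=> kn; have wr := fold_range1 n_ge10 (digit u) (height_range n_ge10 (doubling u)).
have /andP[w0 w1] := fold_range (digit u) (height_range n_ge10 (doubling u)).
have [z zE /andP[z0 zw]] := iter_pull_back_height kn (leqnn n) wr.
exists z; first by rewrite /code_pt (heightE n_ge10).
by rewrite z0 (le_trans zw).
Qed.

Lemma code_pt_semiconj u : iter n.+1 fold_map (code_pt u) = code_pt (doubling u).
Proof.
rewrite iterS code_pt_last fold_mapE plane_pt0 plane_pt1 -baseS base_period.
have /andP[h0 h1] := height_range n_ge10 (doubling u).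
by rewrite (branch_root (digit u) (@width_gt0 R n) h0 h1).
Qed.

Lemma code_pt_in u : trapped (code_pt u).
Proof.
move=> k i; rewrite (divn_eq k n.+1) addnC (iter_orbit code_pt_semiconj) /=.
have kn : (k %% n.+1 <= n)%N by rewrite -ltnS ltn_mod.
have [z -> /andP[z0 z1]] := code_pt_height (iter (k %/ n.+1) doubling u) kn.
have e1 := @width_le1 R n n_ge10; rewrite mxE in_itv/=.
by case: ifP => _; [exact: base_range|apply/andP; split; lra].
Qed.

Lemma code_pt_close e u v k : 2 * eps <= e -> (k < n.+1)%N ->
  euclidean_dist (iter k fold_map (code_pt u)) (iter k fold_map (code_pt v)) < e.
Proof.
move=> ee; rewrite ltnS => kn; have e0 := @width_gt0 R n.
have [y -> /andP[y0 y1]] := code_pt_height u kn.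
have [z -> /andP[z0 z1]] := code_pt_height v kn.
rewrite euclidean_dist_fiber; apply: lt_le_trans ee.
by rewrite ltr_norml; apply/andP; split; lra.
Qed.

Lemma code_pt_separated u v p : digit u != digit v ->
  euclidean_dist (iter n fold_map (code_pt u)) p < eps / 4 ->
  euclidean_dist (iter n fold_map (code_pt v)) p < eps / 4 -> False.
Proof.
rewrite !code_pt_last => uv.
move=> /(le_lt_trans (euclidean_dist_coord _ _ ord_max)) +.
move=> + /(le_lt_trans (euclidean_dist_coord _ _ ord_max)).
rewrite !plane_pt1 !ltr_norml => /andP[h1 h2] /andP[h3 h4].
have e0 := @width_gt0 R n.
have /andP[hu0 hu1] := height_range n_ge10 (doubling u).
have /andP[hv0 hv1] := height_range n_ge10 (doubling v).
have lu := branch_low e0 hu0 hu1; have lv := branch_low e0 hv0 hv1.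
have gu := branch_high e0 hu0 hu1; have gv := branch_high e0 hv0 hv1.
by move: h1 h2 h3 h4 uv; rewrite /w; case: (digit u); case: (digit v) => //; lra.
Qed.

Lemma code_pt_measurable k : measurable_fun setT
  ((fun u => iter k fold_map (code_pt u)) : measurableTypeR R -> @borel 'rV[R]_2).
Proof.
apply: (measurability (rT := @borel 'rV[R]_2) (@open 'rV[R]_2) erefl) => _ [V oV <-].
rewrite setTI.
have cont : continuous (fun y : R => iter k fold_map (plane_pt (base n 0) y)).
  move=> y; apply: continuous_comp; last exact: iter_fold_map_continuous.
  apply: plane_pt_continuous => z; [exact: cvg_cst|exact: cvg_id].
have oP := open_comp (fun y _ => cont y) oV.
have := height_measurable n_ge10 measurableT (open_measurable oP).
by rewrite setTI.
Qed.

Lemma local_entropy_width_ge e : 2 * eps <= e ->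
  ((ln 2 / (2 * n.+1%:R))%:E <=
   local_entropy euclidean_dist trapped (@fold_map R) e)%E.
Proof.
move=> ee; apply: (@coded_local_entropy_ge _ _ _ _ _ n.+1 code_pt e (eps / 4)) => //.
- by have := @width_gt0 R n; lra.
- exact: trapped_stable.
- exact: code_pt_in.
- exact: code_pt_semiconj.
- by move=> u v k; exact: code_pt_close.
- exact: code_pt_separated.
- exact: code_pt_measurable.
Qed.

Lemma tail_entropy_width_gt0 e : 2 * eps <= e ->
  (0 < tail_entropy euclidean_dist trapped (@fold_map R) e)%E.
Proof.
move=> ee; apply: (@coded_tail_entropy_gt0 _ _ _ _ _ n.+1 code_pt e (eps / 4)) => //.
- by have := @width_gt0 R n; lra.
- exact: code_pt_in.
- exact: code_pt_semiconj.
- by move=> u v k; exact: code_pt_close.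
- exact: code_pt_separated.
Qed.

End coded_plane_system.

Lemma small_width {R : realType} (r : R) : 0 < r ->
  exists2 n, (10 <= n)%N & 2 * @width R n < r.
Proof.
move=> r0; pose n := maxn 10 (Num.bound (32 / r)).
exists n; first exact: leq_maxl.
have /andP[_ wn] := @width_bounds R n.
have lt2 : 32 / r < 2 ^+ n.
  apply: lt_trans (archi_boundP _) _; first by rewrite divr_ge0// ltW.
  rewrite -natrX ltr_nat; apply: leq_ltn_trans (ltn_expl n _) => //.
  exact: leq_maxr.
have p0 : 0 < 2 ^+ n :> R by rewrite exprn_gt0.
apply: le_lt_trans (_ : 2 * (16 / 2 ^+ n) < _); first by rewrite ler_wpM2l.
rewrite mulrA ltr_pdivrMr//; move: lt2; rewrite ltr_pdivrMr// mulrC => h.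
by apply: le_lt_trans h; lra.
Qed.

(** width <= 16 / 2^n gives |ln (2 width)| >= (n - 5) ln 2, and
    n - 5 >= (n + 1) / 4 for n >= 10. *)
Lemma ln_width {R : realType} n : (10 <= n)%N ->
  n.+1%:R / 4 * ln 2 <= `|ln (2 * @width R n)|.
Proof.
move=> n10; have /andP[_ wn] := @width_bounds R n; have w0 := @width_gt0 R n.
have p0 : 0 < 2 ^+ n :> R by rewrite exprn_gt0.
have w20 : 0 < 2 * @width R n by lra.
have le32 : 2 * @width R n <= 2 ^+ 5 / 2 ^+ n by rewrite (_ : 2 ^+ 5 = 32); [lra|ring].
have : ln (2 * @width R n) <= ln (2 ^+ 5 / 2 ^+ n).
  by rewrite ler_ln ?posrE// divr_gt0// exprn_gt0.
rewrite ln_div ?posrE ?exprn_gt0// !lnXn// -(mulr_natr (ln 2) 5) -(mulr_natr (ln 2) n) => h.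
rewrite ler_normr; apply/orP; right.
have nR : 10 <= n%:R :> R by rewrite ler_nat.
have l2 : 0 < ln 2 :> R by rewrite ln_gt0// ltr1n.
have -> : n.+1%:R = n%:R + 1 :> R by rewrite -natr1.
by nra.
Qed.

Theorem corollary9 (R : realType) :
  exists (m : nat) (P : 'I_m -> mpoly.mpoly m R) (K : set 'rV[R]_m) (C : R),
    [/\ (1 <= m)%N,
        compact K,
        poly_map P @` K `<=` K,
        0 < C &
        ~ h_expansive euclidean_dist K (poly_map P) /\
        (C%:E < limf_esup
           (fun e : R => local_entropy euclidean_dist K (poly_map P) e *
                         (`|ln e|)%:E)
           (0 : R)^'+)%E].
Proof.
have l2 : 0 < ln 2 :> R by rewrite ln_gt0// ltr1n.
exists 2%N, (@fold_poly R), trapped, (ln 2 ^+ 2 / 16); split => //.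
- exact: trapped_compact.
- by move=> _ [p Kp <-]; exact: trapped_stable.
- by rewrite divr_gt0// exprn_gt0.
split.
  move=> [e e0]; have [n n10 /ltW ne] := small_width e0.
  by apply/eqP; rewrite gt_eqF//; exact: (tail_entropy_width_gt0 n10 ne).
apply: (@lt_le_trans _ _ (ln 2 ^+ 2 / 8)%:E).
  by rewrite lte_fin; have : 0 < ln 2 ^+ 2 :> R; [rewrite exprn_gt0|lra].
apply: le_limf_esup_term => V [r /= r0 rV].
have [n n10 nr] := small_width r0; have w0 := @width_gt0 R n.
exists (2 * @width R n).
  apply: rV => /=; last by lra.
  by rewrite sub0r normrN gtr0_norm; lra.
apply: le_trans (lee_wpmul2r _ (local_entropy_width_ge n10 (lexx _))); last first.
  by rewrite lee_fin.
rewrite -EFinM lee_fin; apply: le_trans (ler_wpM2l _ (ln_width n10)); last first.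
  by rewrite divr_ge0 ?ltW// mulr_gt0// ltr0n.
have : n.+1%:R != 0 :> R by rewrite pnatr_eq0.
move: (n.+1%:R) (ln 2) => m l m0.
by rewrite [leRHS](_ : _ = l ^+ 2 / 8)//; field.
Qed.
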